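(* Let $H$ be a real Hilbert space, $C\subseteq H$ nonempty, closed and convex, and $F:H\to H$ an operator such that (A1) $S_D\neq\emptyset$; (A2) $F$ is quasimonotone; (A3) $F$ is uniformly continuous on $H$; (A4) whenever $\{x_n\}\subset H$ and $x_n\rightharpoonup x$, one has $\|F(x)\|\le\liminf_{n\to\infty}\|F(x_n)\|$; (A5) for every sequence $\{w_n\}\subseteq C$ with $w_n\rightharpoonup u\in S_D$, there exists $\epsilon\ge0$ such that $\liminf_{n\to\infty}\frac{\langle F(w_n),w_n-u\rangle}{\|w_n-u\|^{2+\epsilon}}>0$. Assume moreover that $F(z)\neq0$ for every $z\in S\setminus S_D$. Let $\{z_n\}$ be the sequence generated by Algorithm 3.1 (with stopping tolerance $0$), and assume $z_n\neq w_n$ for all $n$. Then $\{z_n\}$ converges strongly to a point $z^\ell\in S$.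
   Context: $\rightharpoonup$ denotes weak convergence. $P_C$ denotes the metric projection onto $C$. $S$ is the solution set of the variational inequality: $x\in C$ with $\langle F(x),w-x\rangle\ge0$ for all $w\in C$. $S_D$ is the set of $z\in C$ with $\langle F(v),v-z\rangle\ge0$ for all $v\in C$. $F$ is quasimonotone if $\langle F(w),z-w\rangle>0$ implies $\langle F(z),z-w\rangle\ge0$ for all $w,z\in H$. Algorithm 3.1 (with stopping tolerance $0$): fix $\mu\in(0,1)$, a sequence $\{\xi_n\}\subset[0,\infty)$ with $\sum_{n}\xi_n<\infty$, $z_1\in H$ and $\lambda_1>0$. For $n=1,2,\dots$: $w_n=P_C(z_n-\lambda_nF(z_n))$; $z_{n+1}=w_n+\lambda_n(F(z_n)-F(w_n))$; $\lambda_{n+1}=\min\{\frac{\mu\|z_n-w_n\|}{\|F(z_n)-F(w_n)\|},\lambda_n+\xi_n\}$ if $F(z_n)\neq F(w_n)$, and $\lambda_{n+1}=\lambda_n+\xi_n$ otherwise. *)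

(* Defs.v *)
From mathcomp Require Import all_boot all_order all_algebra.
From mathcomp Require Import all_classical all_reals all_analysis.
Set Implicit Arguments. Unset Strict Implicit. Unset Printing Implicit Defensive.
Import Order.TTheory GRing.Theory Num.Theory.
Import numFieldNormedType.Exports.
Local Open Scope classical_set_scope.
Local Open Scope ring_scope.

(* A real Hilbert space is a complete normed space H whose norm comes from an
   inner product [inner]. *)
Definition is_inner_product (R : realType) (H : normedModType R)
  (inner : H -> H -> R) : Prop :=
  [/\ (forall x y, inner x y = inner y x),
      (forall x y z, inner (x + y) z = inner x z + inner y z),
      (forall (a : R) x y, inner (a *: x) y = a * inner x y) &
      (forall x, inner x x = `|x| ^+ 2)].

Definition convex_subset (R : realType) (H : normedModType R) (C : set H) :=
  forall x y (t : R), C x -> C y -> 0 <= t -> t <= 1 ->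
    C (t *: x + (1 - t) *: y).

Definition weak_cvg (R : realType) (H : normedModType R)
  (inner : H -> H -> R) (x : nat -> H) (y : H) : Prop :=
  forall v, (fun n => inner (x n) v) @ \oo --> inner y v.

Definition is_metric_proj (R : realType) (H : normedModType R)
  (C : set H) (x p : H) : Prop :=
  C p /\ (forall y, C y -> `|x - p| <= `|x - y|).

Definition VI_sol (R : realType) (H : normedModType R)
  (inner : H -> H -> R) (C : set H) (F : H -> H) : set H :=
  [set x | C x /\ forall w, C w -> 0 <= inner (F x) (w - x)].

Definition VI_dual_sol (R : realType) (H : normedModType R)
  (inner : H -> H -> R) (C : set H) (F : H -> H) : set H :=
  [set z | C z /\ forall v, C v -> 0 <= inner (F v) (v - z)].

Definition quasimonotone (R : realType) (H : normedModType R)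
  (inner : H -> H -> R) (F : H -> H) : Prop :=
  forall w z, 0 < inner (F w) (z - w) -> 0 <= inner (F z) (z - w).

(* Main.v *)
(* The step sizes need not stay away from 0, since F is only uniformly
   continuous.  For u in S_D, |z_n - u| decreases whenever
   lambda_{n+1} >= q lambda_n with mu < q < 1.  In the other steps lambda loses
   a fixed proportion of its value, so the lambda_n over those steps are
   summable; uniform continuity shows that eventually z_n moves by O(lambda_n)
   there.  Hence (z_n) is quasi-Fejer monotone with respect to S_D, and
   z_n - w_n -> 0.  Moreover |z_n - w_n| / lambda_n is small infinitely often,
   since otherwise lambda_n -> 0 although lambda would eventually be
   nondecreasing.  Along such indices w_n almost solves the variational
   inequality, so its weak cluster points lie in S_D (quasimonotonicity, lower
   semicontinuity of |F|), (A5) upgrades weak to strong convergence, and the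
   quasi-Fejer property carries it over to the whole sequence. *)
Require Import Defs.
From mathcomp Require Import all_boot all_order all_algebra.
From mathcomp Require Import all_classical all_reals all_analysis.
From mathcomp Require Import ring lra.
Import Order.TTheory GRing.Theory Num.Theory.
Import numFieldNormedType.Exports.
Local Open Scope classical_set_scope.
Local Open Scope ring_scope.
Set Implicit Arguments.
Unset Strict Implicit.
Unset Printing Implicit Defensive.

(** * Inner-product identities and the variational characterisation of projections *)

Section InnerProduct.
Context (R : realType) (H : normedModType R) (inner : H -> H -> R).
Hypothesis ip : is_inner_product inner.

Lemma innerC x y : inner x y = inner y x. Proof. by case: ip. Qed.

Lemma innerDl x y z : inner (x + y) z = inner x z + inner y z.
Proof. by case: ip. Qed.

Lemma innerZl (a : R) x y : inner (a *: x) y = a * inner x y.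
Proof. by case: ip. Qed.

Lemma innerxx x : inner x x = `|x| ^+ 2. Proof. by case: ip. Qed.

Lemma innerNl x y : inner (- x) y = - inner x y.
Proof. by rewrite -scaleN1r innerZl mulN1r. Qed.

Lemma innerBl x y z : inner (x - y) z = inner x z - inner y z.
Proof. by rewrite innerDl innerNl. Qed.

Lemma innerDr x y z : inner z (x + y) = inner z x + inner z y.
Proof. by rewrite innerC innerDl ![inner _ z]innerC. Qed.

Lemma innerZr (a : R) x y : inner y (a *: x) = a * inner y x.
Proof. by rewrite innerC innerZl innerC. Qed.

Lemma innerNr x y : inner y (- x) = - inner y x.
Proof. by rewrite innerC innerNl innerC. Qed.

Lemma inner0l x : inner 0 x = 0.
Proof. by rewrite -(scale0r 0) innerZl mul0r. Qed.

Definition innerE := (innerDl, innerDr, innerNl, innerNr, innerZl, innerZr).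

Lemma sqr_normD x y : `|x + y| ^+ 2 = `|x| ^+ 2 + 2 * inner x y + `|y| ^+ 2.
Proof. by rewrite -!innerxx !innerE (innerC y x); ring. Qed.

Lemma sqr_normB x y : `|x - y| ^+ 2 = `|x| ^+ 2 - 2 * inner x y + `|y| ^+ 2.
Proof. by rewrite sqr_normD innerNr normrN; ring. Qed.

(** Cauchy-Schwarz falls out of squaring the triangle inequality, which the norm already
    satisfies. *)
Lemma inner_le_norm x y : inner x y <= `|x| * `|y|.
Proof.
have := ler_normD x y; rewrite -(@ler_pXn2r _ 2) ?nnegrE ?addr_ge0//.
by rewrite sqr_normD; lra.
Qed.

Lemma normr_inner_le x y : `|inner x y| <= `|x| * `|y|.
Proof.
rewrite ler_norml inner_le_norm andbT -(normrN x).
by have := inner_le_norm (- x) y; rewrite innerNl; lra.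
Qed.

Lemma cvg_innerl (T : Type) (G : set_system T) (FG : Filter G)
    (f : T -> H) l v :
  f @ G --> l -> (fun t => inner (f t) v) @ G --> inner l v.
Proof.
move=> fl; apply/cvgrPdist_lt => e e0.
have d0 : 0 < e / (`|v| + 1) by rewrite divr_gt0// ltr_wpDl.
move/cvgrPdist_lt: fl => /(_ _ d0); apply: filterS => t.
rewrite ltr_pdivlMr ?ltr_wpDl// => lt_e.
rewrite -innerBl; apply: le_lt_trans (normr_inner_le _ _) _.
by apply: le_lt_trans lt_e; rewrite ler_wpM2l// lerDl.
Qed.

(** Parallelogram law; its last term is the uniform convexity used in both minimisation problems
    below. *)
Lemma sqr_norm_midpoint (x u v : H) :
  `|x - 2^-1 *: (u + v)| ^+ 2 =
  (`|x - u| ^+ 2 + `|x - v| ^+ 2) / 2 - `|u - v| ^+ 2 / 4.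
Proof.
by rewrite -!innerxx !innerE (innerC u x) (innerC v x) (innerC v u); field.
Qed.

(** If the angle at [p] were acute, a short move from [p] towards [y] would come closer to [x]. *)
Lemma metric_proj_inner_le (C : set H) (x p y : H) : convex_subset C ->
  is_metric_proj C x p -> C y -> inner (x - p) (y - p) <= 0.
Proof.
move=> Ccvx [Cp xp] Cy; rewrite leNgt; apply/negP => a0.
set a := inner _ _ in a0.
pose b := `|y - p| ^+ 2; have b0 : 0 <= b by rewrite sqr_ge0.
(* The best step would be [a / b]; the denominator [a + b] keeps [t] at most 1 and covers
   [b = 0]. *)
pose t := a / (a + b); have ab0 : 0 < a + b by lra.
have t0 : 0 < t by rewrite divr_gt0.
have t1 : t <= 1 by rewrite ler_pdivrMr// mul1r; lra.
have := xp _ (Ccvx _ _ _ Cy Cp (ltW t0) t1).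
have -> : x - (t *: y + (1 - t) *: p) = (x - p) - t *: (y - p).
  rewrite -addrA -opprD; congr (x - _).
  by rewrite scalerBr scalerBl scale1r addrCA.
rewrite -(@ler_pXn2r _ 2) ?nnegrE// (sqr_normB (x - p)) innerZr normrZ.
rewrite exprMn real_normK ?num_real//.
rewrite -/a -/b => le_t.
have : 2 * a <= t * b by rewrite -(ler_pM2l t0); nra.
by rewrite /t mulrAC ler_pdivlMr//; nra.
Qed.

End InnerProduct.

(** * Consequences of completeness: projections, Riesz representation, weak compactness *)

Section Hilbert.
Context (R : realType) (H : completeNormedModType R) (inner : H -> H -> R).
Hypothesis ip : is_inner_product inner.

Lemma cauchy_seq_cvg (x : nat -> H) :
  (forall e : R, 0 < e -> exists N, forall i j, (N <= i)%N -> (N <= j)%N ->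
     `|x i - x j| < e) -> cvg (x @ \oo).
Proof.
move=> xC; apply/cauchy_cvgP/cauchy_exP => e e0.
have [N NC] := xC _ e0; exists (x N); exists N => // n /= Nn.
by rewrite -ball_normE /=; apply: NC.
Qed.

(* Uniform convexity forces every minimising sequence to be Cauchy. *)
Lemma midpoint_convex_min (C : set H) (G : H -> R) :
  C !=set0 -> closed C ->
  (forall x y, C x -> C y -> C (2^-1 *: (x + y))) ->
  (forall x, C x -> 0 <= G x) -> continuous G ->
  (forall x y, C x -> C y ->
     G (2^-1 *: (x + y)) <= (G x + G y) / 2 - `|x - y| ^+ 2 / 4) ->
  exists2 p, C p & forall y, C y -> G p <= G y.
Proof.
move=> [x0 Cx0] Ccl Cmid G0 Gcont Gmid.
have GCinf : has_inf (G @` C).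
  by split; [exists (G x0); exists x0|exists 0 => _ [x Cx <-]; exact: G0].
pose m := inf (G @` C).
have mG y : C y -> m <= G y by move=> Cy; apply: ge_inf; [case: GCinf|exists y].
pose d (n : nat) : R := n.+1%:R^-1.
have d_lt e : 0 < e -> \forall n \near \oo, d n < e.
  by move=> e0; exact: near_infty_natSinv_lt (PosNum e0).
have xE (n : nat) : exists x, C x /\ G x < m + d n.
  have [|_ [x Cx <-] xm] := @inf_adherent _ _ (d n) _ GCinf.
    by rewrite invr_gt0.
  by exists x.
have {xE}[x xE] := @choice _ _ _ xE.
have /cvg_ex[p xp] : cvg (x @ \oo).
  apply: cauchy_seq_cvg => e e0.
  (* Both values will be within [e ^+ 2 / 4] of the infimum and the midpoint value is not below it,
     so the gap in [Gmid] is less than [e ^+ 2 / 4]. *)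
  have [N _ NP] : \forall n \near \oo, d n < e ^+ 2 / 4.
    by apply: d_lt; rewrite divr_gt0 ?exprn_gt0.
  exists N => i j /NP/= iN /NP/= jN.
  have [Ci Gi] := xE i; have [Cj Gj] := xE j.
  have := mG _ (Cmid _ _ Ci Cj); have := Gmid _ _ Ci Cj.
  by rewrite -(@ltr_pXn2r _ 2) ?nnegrE ?(ltW e0)//; lra.
exists p.
  by apply: (closed_cvg C Ccl _ _ xp); apply: nearW => n; case: (xE n).
move=> y /mG; apply: le_trans.
have Gx : G (x n) @[n --> \oo] --> G p.
  by apply: continuous_cvg xp; exact: Gcont.
apply/ler_addgt0Pr => e e0.
have e2 : 0 < e / 2 by rewrite divr_gt0.
near \oo => n.
have : `|G p - G (x n)| < e / 2.
  by near: n; move/cvgrPdist_lt: Gx; exact.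
have : d n < e / 2 by near: n; exact: d_lt.
have [_] := xE n; rewrite ltr_distlC => *; lra.
Unshelve. all: by end_near. Qed.

Lemma metric_proj_ex (C : set H) (x : H) : C !=set0 -> closed C ->
  convex_subset C -> exists p, is_metric_proj C x p.
Proof.
move=> C0 Ccl Ccvx.
have [||||p Cp pmin] := @midpoint_convex_min C (fun v => `|x - v| ^+ 2) C0 Ccl.
- move=> u v Cu Cv; rewrite scalerDr.
  have := Ccvx u v 2^-1 Cu Cv.
  by rewrite (_ : 1 - 2^-1 = 2^-1); [apply; lra|field].
- by move=> ? _; rewrite sqr_ge0.
- have nc : continuous (fun v => `|x - v|).
    by move=> v; apply: cvg_norm; apply: cvgB; [exact: cvg_cst|exact: cvg_id].
  by move=> v; exact: cvgM (nc v) (nc v).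
- by move=> u v _ _; rewrite (sqr_norm_midpoint ip).
by exists p; split=> // y /pmin; rewrite ler_pXn2r ?nnegrE.
Qed.

(** The minimiser of [|v|^2 - 2 L v] represents [L], because the first variation vanishes there. The
    added [M ^+ 2] makes the functional nonnegative. *)
Lemma riesz_representation (L : H -> R) (M : R) :
  (forall x y, L (x + y) = L x + L y) -> (forall a x, L (a *: x) = a * L x) ->
  (forall x, `|L x| <= M * `|x|) -> exists p, forall v, L v = inner p v.
Proof.
move=> LD LZ LM.
have LB x y : L (x - y) = L x - L y by rewrite LD -scaleN1r LZ mulN1r.
have [||||||p _ pmin] := @midpoint_convex_min setT
   (fun v => `|v| ^+ 2 - 2 * L v + M ^+ 2).
- by exists 0.
- exact: closedT.
- by [].
- move=> x _; have := LM x; rewrite ler_norml => /andP[_ LxM].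
  by have := sqr_ge0 (`|x| - M); nra.
- have Lc : continuous L.
    move=> v; apply/cvgrPdist_lt => e e0.
    have M0 : 0 < `|M| + 1 by rewrite ltr_wpDl.
    have d0 : 0 < e / (`|M| + 1) by rewrite divr_gt0.
    near=> u; rewrite -LB; apply: le_lt_trans (LM _) _.
    have : `|v - u| < e / (`|M| + 1).
      by near: u; move/cvgrPdist_lt: (@cvg_id _ (nbhs v)); apply.
    rewrite ltr_pdivlMr// => h; apply: le_lt_trans h.
    by rewrite mulrC ler_wpM2l// ler_wpDr// ler_norm.
  have nc : continuous (fun v : H => `|v|) by exact: norm_continuous.
  move=> v; apply: cvgD; last exact: cvg_cst.
  apply: cvgB; first exact: cvgM (nc v) (nc v).
  by apply: cvgM; [exact: cvg_cst|exact: Lc].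
- move=> x y _ _; rewrite LZ LD.
  by have := sqr_norm_midpoint ip 0 x y; rewrite !sub0r !normrN; lra.
exists p => v.
set a := L v; set b := inner p v; pose c := `|v| ^+ 2.
have c0 : 0 <= c by rewrite sqr_ge0.
have key t : 0 <= 2 * t * (b - a) + t ^+ 2 * c.
  have := pmin (p + t *: v) I.
  rewrite (sqr_normD ip) LD LZ normrZ exprMn real_normK ?num_real//.
  by rewrite (innerZr ip) -/a -/b -/c; lra.
have c1 : 0 < c + 1 by lra.
(* A nearly optimal [t] for the quadratic [key]; [c + 1] in place of [c] avoids dividing by zero
   when [v = 0]. *)
have := key (- (b - a) / (c + 1)).
have -> : 2 * (- (b - a) / (c + 1)) * (b - a) + (- (b - a) / (c + 1)) ^+ 2 * c
   = - ((b - a) ^+ 2 * ((c + 2) / (c + 1) ^+ 2)).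
  by field; rewrite lt0r_neq0.
rewrite oppr_ge0 pmulr_lle0; last by rewrite divr_gt0 ?exprn_gt0//; lra.
by move=> ba0; apply/esym/eqP; rewrite -subr_eq0 -sqrf_eq0 eq_le ba0 sqr_ge0.
Unshelve. all: by end_near. Qed.

(** With [q] the projection of [p], the projection inequality at each [x n] is linear in [x n], so
    it passes to the weak limit and reads [|p - q|^2 <= 0]. *)
Lemma weak_cvg_closed_convex (C : set H) (x : nat -> H) (p : H) : closed C ->
  convex_subset C -> (forall n, C (x n)) -> weak_cvg inner x p -> C p.
Proof.
move=> Ccl Ccvx Cx xp.
have [|q Pq] := @metric_proj_ex C p _ Ccl Ccvx; first by exists (x 0%N).
have : inner p (p - q) <= inner q (p - q).
  apply: (closed_cvg _ (@closed_le R _) _ _ (xp _)); apply: nearW => n /=.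
  have := metric_proj_inner_le ip Ccvx Pq (Cx n).
  by rewrite (innerC ip) (innerBl ip); lra.
rewrite -subr_le0 -(innerBl ip) (innerxx ip) => h.
have /eqP : `|p - q| ^+ 2 = 0 by apply/eqP; rewrite eq_le h sqr_ge0.
by rewrite sqrf_eq0 normr_eq0 subr_eq0 => /eqP ->; case: Pq.
Qed.

(** Compactness of the segment gives a cluster point, and a cluster point of an ultrafilter is a
    limit. *)
Lemma ultra_bounded_cvg (T : Type) (U : set_system T) (f : T -> R) (M : R) :
  UltraFilter U -> (forall t, `|f t| <= M) -> cvg (f @ U).
Proof.
move=> UU fM; have UP : ProperFilter U by exact: ultra_proper.
have [|l [_ lcl]] := @segment_compact R (- M) M (f @ U) _.
  by apply: (@filterE _ U) => t /=; rewrite in_itv/= -ler_norml.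
apply/cvg_ex; exists l => A lA.
have [//|UA] := in_ultra_setVsetC (f @^-1` A) UU.
by have [r []] := lcl (~` A) A UA lA.
Qed.

(* The limit is found along an ultrafilter; the sequence is then chosen so that
   [{v | inner (x (s k) - p) v --> 0}], a closed subspace, contains every
   [x (s k) - p], hence equals its own bi-orthogonal complement, [H]. *)
Lemma bounded_weak_subseq (x : nat -> H) (M : R) : (forall n, `|x n| <= M) ->
  exists (s : nat -> nat) (p : H),
    (forall k, (k <= s k)%N) /\ weak_cvg inner (x \o s) p.
Proof.
move=> xM.
have [U [UU ooU]] := ultraFilterLemma eventually_filter.
have UP : ProperFilter U by exact: ultra_proper.
pose L v := lim (inner (x n) v @[n --> U]).
have LE v : inner (x n) v @[n --> U] --> L v.
  apply: (@ultra_bounded_cvg _ _ _ (M * `|v|)) => n.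
  by apply: le_trans (normr_inner_le ip _ _) _; rewrite ler_wpM2r.
have [|||p Lp] := @riesz_representation L M.
- move=> u v; apply: cvg_lim => //.
  under eq_fun do rewrite (innerDr ip).
  exact: cvgD.
- move=> a v; apply: cvg_lim => //.
  under eq_fun do rewrite (innerZr ip).
  by apply: cvgM; [exact: cvg_cst|exact: LE].
- move=> v; apply: (closed_cvg _ (@closed_le R _) _ _ (cvg_norm (LE v))).
  apply: nearW => n /=.
  by apply: le_trans (normr_inner_le ip _ _) _; rewrite ler_wpM2r.
have Up v e : 0 < e -> \forall n \near U, `|inner (x n - p) v| < e.
  move=> e0; have := LE v; rewrite Lp => /cvgrPdist_lt/(_ _ e0).
  by apply: filterS => n; rewrite distrC (innerBl ip).
(* Stage [k] imposes finitely many conditions, each holding on a set of [U], so some index meets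
   them all. *)
have /choice[s sP] : forall k, exists n, [/\ (k <= n)%N,
    `|inner (x n - p) p| < k.+1%:R^-1 &
    forall m : 'I_k.+1, `|inner (x n - p) (x m)| < k.+1%:R^-1].
  move=> k; have k0 : 0 < (k.+1%:R^-1 : R) by rewrite invr_gt0.
  apply: (@filter_ex _ U); near=> n; split.
  - by near: n; apply: ooU; exact: nbhs_infty_ge.
  - by near: n; exact: Up.
  - by near: n; apply: filter_forall => m; exact: Up.
exists s, p; split; first by move=> k; case: (sP k).
pose d k := x (s k) - p.
have dM k : `|d k| <= M + `|p|.
  by apply: le_trans (ler_normB _ _) _; rewrite lerD2r.
have M0 : 0 <= M + `|p| by apply: le_trans (dM 0%N).
suff d0 : forall v, inner (d k) v @[k --> \oo] --> 0.
  move=> v; apply/subr_cvg0; apply: cvg_trans (d0 v).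
  by apply: near_eq_cvg; apply: nearW => k /=; rewrite (innerBl ip).
pose V := [set v | inner (d k) v @[k --> \oo] --> 0].
have VZ a v : V v -> V (a *: v).
  rewrite /V /= => Vv; rewrite -[X in _ --> X](mulr0 a).
  under eq_fun do rewrite (innerZr ip).
  by apply: cvgM; [exact: cvg_cst|exact: Vv].
have VD u v : V u -> V v -> V (u + v).
  rewrite /V /= => Vu Vv; rewrite -[X in _ --> X](addr0 0).
  under eq_fun do rewrite (innerDr ip).
  exact: cvgD.
have Vlt v : (\forall k \near \oo, `|inner (d k) v| < k.+1%:R^-1) -> V v.
  move=> h; apply/cvgrPdist_lt => e e0; near=> k.
  rewrite sub0r normrN; apply: (@lt_trans _ _ (k.+1%:R^-1)); near: k => //.
  exact: near_infty_natSinv_lt (PosNum e0).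
(* From stage [s m] on, [x (s m)] is among the vectors controlled, and [p] is controlled at every
   stage. *)
have Vd m : V (d m).
  apply: VD.
    apply: Vlt; exists (s m) => // k /=; rewrite -ltnS => mk.
    by case: (sP k) => _ _ /(_ (Ordinal mk)).
  by rewrite -scaleN1r; apply: VZ; apply: Vlt; apply: nearW => k; case: (sP k).
have V0 : V 0 by rewrite -(scale0r (d 0%N)); exact: VZ.
have Vcl : closed V.
  move=> v clv; apply/cvgrPdist_lt => e e0.
  have M1 : 0 < 2 * (M + `|p| + 1) by rewrite mulr_gt0// ltr_wpDl.
  have e1 : 0 < e / (2 * (M + `|p| + 1)) by rewrite divr_gt0.
  have [u [Vu]] := clv _ (nbhsx_ballx v _ e1).
  rewrite -ball_normE /= ltr_pdivlMr// => uv.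
  have e2 : 0 < e / 2 by rewrite divr_gt0.
  move/cvgrPdist_lt: Vu => /(_ _ e2); apply: filterS => k.
  rewrite !sub0r !normrN => dku.
  have -> : inner (d k) v = inner (d k) u + inner (d k) (v - u).
    by rewrite -(innerDr ip) addrC subrK.
  apply: le_lt_trans (ler_normD _ _) _.
  have := normr_inner_le ip (d k) (v - u); have := dM k.
  by have := normr_ge0 (v - u); nra.
have Vcvx : convex_subset V by move=> u v t Vu Vv _ _; apply: VD; exact: VZ.
move=> v; have [|q Pq] := @metric_proj_ex V v _ Vcl Vcvx; first by exists 0.
have [Vq _] := Pq.
(* Since [V] is a subspace, [u + q] may be tested. Applied to [d k] and its opposite this gives
   orthogonality, and a vector orthogonal to every [d k] lies in [V]. *)
have orth u : V u -> inner (v - q) u <= 0.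
  move=> Vu; rewrite -[u](addrK q).
  by apply: (metric_proj_inner_le ip Vcvx Pq); exact: VD.
have Vvq : V (v - q).
  apply: Vlt; apply: nearW => k; rewrite (innerC ip).
  suff -> : inner (v - q) (d k) = 0 by rewrite normr0 invr_gt0.
  apply/eqP; rewrite eq_le orth//=.
  by have := orth _ (VZ (-1) _ (Vd k)); rewrite (innerZr ip); lra.
by rewrite -[v](subrK q); exact: VD.
Unshelve. all: by end_near. Qed.

End Hilbert.

(** The lower limit is the supremum of the tail infima, so one tail infimum already exceeds [c]. *)
Lemma limn_einf_gt_near (R : realType) (u : nat -> \bar R) (c : \bar R) :
  (c < limn_einf u)%E -> \forall n \near \oo, (c < u n)%E.
Proof.
rewrite limn_einf_lim (cvg_lim _ (@cvg_einfs_sup _ u))//.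
move=> /ereal_sup_gt[_ [N _ <-]] cN; exists N => // n /= Nn.
by apply: lt_le_trans cN _; apply: ereal_inf_lbound; exists n.
Qed.

(** * Uniform continuity: moduli and at most affine growth *)

Section UniformContinuity.
Context (R : realType) (H K : normedModType R) (F : H -> K).
Hypothesis Fuc : unif_continuous F.

Lemma unif_continuous_normP (e : R) : 0 < e ->
  exists2 d, 0 < d & forall x y, `|x - y| < d -> `|F x - F y| < e.
Proof.
move=> e0; have [d d0 dP] := (unif_continuousP F).1 Fuc e e0.
exists d => // x y xy; have := dP (x, y).
by rewrite -!ball_normE; exact.
Qed.

Lemma unif_continuous_continuous : continuous F.
Proof.
move=> x; apply/cvgrPdist_lt => e e0.
have [d d0 dP] := unif_continuous_normP e0.
near=> y; apply: dP; near: y.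
by move/cvgrPdist_lt: (@cvg_id _ (nbhs x)); apply.
Unshelve. all: by end_near. Qed.

(* Subdivide the segment from [x] to [y] into pieces of length at most [d]. *)
Lemma unif_continuous_affine_bound :
  exists2 M : R, 0 <= M & forall x y, `|F x - F y| <= M * `|x - y| + 1.
Proof.
have [d d0 dP] := unif_continuous_normP ltr01.
have d20 : 0 < d / 2 by rewrite divr_gt0.
have chain n x y : `|x - y| <= n%:R * (d / 2) -> `|F x - F y| <= n%:R.
  elim: n x y => [|n IHn] x y.
    by rewrite mul0r normr_le0 subr_eq0 => /eqP ->; rewrite subrr normr0.
  move=> xy; pose t : R := n.+1%:R^-1; pose m := x + t *: (y - x).
  have n0 : n.+1%:R != 0 :> R by rewrite pnatr_eq0.
  have t0 : 0 <= t by rewrite invr_ge0.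
  have xm : `|x - m| < d.
    rewrite opprD addNKr normrN normrZ ger0_norm// distrC.
    apply: (@le_lt_trans _ _ (d / 2)); last lra.
    by rewrite ler_pdivrMl// ltr0Sn.
  have my : `|m - y| <= n%:R * (d / 2).
    have -> : m - y = (1 - t) *: (x - y).
      rewrite /m scalerBl scale1r -[y - x]opprB scalerN.
      by rewrite addrAC.
    have tn : 1 - t = n%:R / n.+1%:R.
      by apply: (mulIf n0); rewrite mulrBl mulVf// divfK// mul1r -natr1 addrK.
    rewrite normrZ tn ger0_norm ?divr_ge0// -mulrA ler_wpM2l//.
    by rewrite ler_pdivrMl ?ltr0Sn.
  apply: le_trans (ler_distD (F m) _ _) _.
  by rewrite -natr1 addrC lerD ?IHn// ltW ?dP.
exists (d / 2)^-1; first by rewrite invr_ge0 ltW.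
(* Rounding the number of pieces up to [n.+1] is what produces the additive 1. *)
move=> x y; pose n := Num.truncn (`|x - y| / (d / 2)).
have /Num.Theory.truncn_itv/andP[nle ltn] : 0 <= `|x - y| / (d / 2).
  by rewrite divr_ge0// ltW.
apply: le_trans (chain n.+1 _ _ _) _.
  by rewrite -ler_pdivrMr// ltW.
by rewrite -natr1 lerD2r mulrC.
Qed.

End UniformContinuity.

(** * Solutions, dual solutions and weak cluster points of approximate solutions *)

Section VariationalInequality.
Context (R : realType) (H : normedModType R) (inner : H -> H -> R).
Hypothesis ip : is_inner_product inner.
Implicit Types (C : set H) (F : H -> H).

(** Minty's argument: test the dual inequality at [x + t (y - x)], divide by [t] and let [t] tend to
    0. *)
Lemma VI_dual_sol_sub C F : convex_subset C -> continuous F ->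
  VI_dual_sol inner C F `<=` VI_sol inner C F.
Proof.
move=> Ccvx Fc x [Cx xdual]; split=> // y Cy.
pose t (n : nat) : R := n.+1%:R^-1.
have tx : x + t n *: (y - x) @[n --> \oo] --> x.
  rewrite -[X in _ --> X]addr0 -(scale0r (y - x)).
  apply: cvgD; first exact: cvg_cst.
  apply: cvgZr_tmp; apply/cvgrPdist_lt => e e0; near=> n.
  rewrite sub0r normrN ger0_norm ?invr_ge0//; near: n.
  exact: near_infty_natSinv_lt (PosNum e0).
have Ftx : F (x + t n *: (y - x)) @[n --> \oo] --> F x.
  by apply: continuous_cvg tx; exact: Fc.
apply: (closed_cvg _ (@closed_ge R _) _ _ (cvg_innerl ip _ Ftx)).
apply: nearW => n /=.
have t0 : 0 < t n by rewrite invr_gt0.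
have := xdual (x + t n *: (y - x)); rewrite addrAC subrr add0r (innerZr ip).
rewrite pmulr_rge0//; apply.
rewrite scalerBr addrCA -[X in _ + (X - _)]scale1r -scalerBl.
by apply: Ccvx => //; [exact: ltW|rewrite invf_le1// ler1n].
Unshelve. all: by end_near. Qed.

(* Test the approximate inequality at [y + t F(v n)/|F(v n)|^2] with [t] just
   above the defect: the value becomes positive and quasimonotonicity applies. *)
Lemma weak_limit_dual_sol C F (v : nat -> H) (p : H) (r : nat -> R) (M : R) :
  quasimonotone inner F -> continuous F ->
  (`|F p|%:E <= limn_einf (fun n => `|F (v n)|%:E))%E ->
  (forall n, `|v n| <= M) -> weak_cvg inner v p ->
  (forall n, 0 <= r n) -> r @ \oo --> 0 ->
  (forall n y, C y -> - (r n * `|y - v n|) <= inner (F (v n)) (y - v n)) ->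
  C p -> F p != 0 -> VI_dual_sol inner C F p.
Proof.
move=> Fqm Fc Flsc vM vp r0 rcvg vC Cp Fp0; split=> // y Cy.
have c0 : 0 < `|F p| / 2 by rewrite divr_gt0// normr_gt0.
set c := `|F p| / 2 in c0.
have Fv : \forall n \near \oo, c < `|F (v n)|.
  have : (c%:E < limn_einf (fun n => `|F (v n)|%:E))%E.
    by apply: lt_le_trans Flsc; rewrite lte_fin; move: c0; rewrite /c; lra.
  by move/limn_einf_gt_near; apply: filterS => n; rewrite lte_fin.
(* The first term dominates the defect [r n * |y - v n|]; the second makes the tested value strictly
   positive. *)
pose t n : R := r n * (`|y| + M) + n.+1%:R^-1.
have yM n : `|y - v n| <= `|y| + M.
  by apply: le_trans (ler_normB _ _) _; rewrite lerD2l.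
have yM0 : 0 <= `|y| + M by apply: le_trans (yM 0%N).
have t0 n : 0 < t n by rewrite ltr_wpDl ?invr_gt0// mulr_ge0.
have tcvg : t @ \oo --> 0.
  rewrite -[X in _ --> X](addr0 0) -[X in _ --> X + _](mul0r (`|y| + M)).
  apply: cvgD; first by apply: cvgM => //; exact: cvg_cst.
  apply/cvgrPdist_lt => e e0; near=> n.
  rewrite sub0r normrN ger0_norm ?invr_ge0//; near: n.
  exact: near_infty_natSinv_lt (PosNum e0).
pose e n := (t n / `|F (v n)| ^+ 2) *: F (v n).
have eE : \forall n \near \oo, `|e n| <= t n / c.
  apply: filterS Fv => n cF; have Fn0 : 0 < `|F (v n)| by exact: lt_trans cF.
  rewrite normrZ ger0_norm ?divr_ge0 ?sqr_ge0 ?(ltW (t0 n))//.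
  rewrite expr2 invfM mulrA mulfVK ?gt_eqF//.
  by rewrite ler_wpM2l ?(ltW (t0 n))// lef_pV2 ?posrE// ltW.
have ecvg : e @ \oo --> 0.
  apply/cvgr0Pnorm_lt => eps eps0.
  have epsc : 0 < eps * c by rewrite mulr_gt0.
  move/cvgr0Pnorm_lt: tcvg => /(_ _ epsc) tlt; near=> n.
  have : `|e n| <= t n / c by near: n.
  move/le_lt_trans; apply; rewrite ltr_pdivrMr//.
  by apply: le_lt_trans (ler_norm _) _; near: n.
have yecvg : F (y + e n) @[n --> \oo] --> F y.
  have h : y + e n @[n --> \oo] --> y.
    by rewrite -[X in _ --> X]addr0; apply: cvgD => //; exact: cvg_cst.
  by apply: continuous_cvg h; exact: Fc.
have pos : \forall n \near \oo, 0 <= inner (F (y + e n)) (y + e n - v n).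
  apply: filterS Fv => n cF; apply: Fqm.
  have Fn0 : 0 < `|F (v n)| by exact: lt_trans cF.
  rewrite addrAC (innerDr ip) (innerZr ip) (innerxx ip).
  rewrite divfK ?gt_eqF ?exprn_gt0//.
  have := vC n _ Cy; have := ler_wpM2l (r0 n) (yM n).
  have : 0 < (n.+1%:R^-1 : R) by rewrite invr_gt0.
  by rewrite /t; set b : R := n.+1%:R^-1; lra.
have lim1 : inner (F y) (y - v n) @[n --> \oo] --> inner (F y) (y - p).
  under eq_fun do rewrite (innerC ip) (innerBl ip).
  rewrite (innerC ip) (innerBl ip); apply: cvgB; [exact: cvg_cst|exact: vp].
have lim2 : inner (F (y + e n)) (y + e n - v n) - inner (F y) (y - v n)
    @[n --> \oo] --> 0.
  apply/cvgr0Pnorm_lt => eps eps0.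
  (* Both error terms together are at most [d * (B - 1)]; the spare 1 in [B] makes the final bound
     strict. Boundedness of [v] is what compensates for its merely weak convergence. *)
  pose B := `|F y| + (`|y| + M + 1) + 1.
  have B0 : 0 < B by rewrite /B; have := normr_ge0 (F y); lra.
  pose d := Num.min 1 (eps / B).
  have d0 : 0 < d by rewrite lt_min ltr01 divr_gt0.
  have [d1 dB] : d <= 1 /\ d * B <= eps.
    by split; [rewrite ge_min lexx|rewrite -ler_pdivlMr// ge_min lexx orbT].
  move/cvgr0Pnorm_lt: ecvg => /(_ _ d0) elt.
  move/cvgrPdist_lt: yecvg => /(_ _ d0) ylt.
  near=> n.
  have ed : `|e n| < d by near: n.
  have yd : `|F (y + e n) - F y| < d by rewrite distrC; near: n.
  have -> : inner (F (y + e n)) (y + e n - v n) - inner (F y) (y - v n) =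
     inner (F (y + e n) - F y) (y + e n - v n) + inner (F y) (e n).
    by rewrite (innerBl ip) addrAC !(innerDr ip); ring.
  apply: le_lt_trans (ler_normD _ _) _.
  have h1 := normr_inner_le ip (F (y + e n) - F y) (y + e n - v n).
  have h2 := normr_inner_le ip (F y) (e n).
  have h3 : `|y + e n - v n| <= `|y| + M + 1.
    rewrite addrAC; apply: le_trans (ler_normD _ _) _.
    by have := yM n; lra.
  have h4 : `|F (y + e n) - F y| * `|y + e n - v n| <= d * (`|y| + M + 1).
    by apply: ler_pM => //; exact: ltW.
  have h5 : `|F y| * `|e n| <= `|F y| * d by rewrite ler_wpM2l// ltW.
  by rewrite /B in dB; lra.
have lim3 : inner (F (y + e n)) (y + e n - v n) @[n --> \oo] -->
    inner (F y) (y - p).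
  rewrite -[X in _ --> X]add0r; apply: cvg_trans (cvgD lim2 lim1).
  by apply: near_eq_cvg; apply: nearW => n; rewrite /= fctE subrK.
by apply: (closed_cvg _ (@closed_ge R _) _ _ lim3).
Unshelve. all: by end_near. Qed.

(** Far from [p], the quotient in [A5] bounds the inner product below by a fixed positive number,
    against the upper bound [r n] tending to 0. *)
Lemma weak_limit_strong_cluster C F (v : nat -> H) (p : H) (r : nat -> R) :
  (forall (x : nat -> H) (u : H),
     (forall n, C (x n)) -> (forall n, x n != u) ->
     VI_dual_sol inner C F u -> weak_cvg inner x u ->
     exists2 eps : R, 0 <= eps &
       (0 < limn_einf (fun n =>
          (inner (F (x n)) (x n - u) / (`|x n - u| `^ (2 + eps)))%:E))%E) ->
  (forall n, C (v n)) -> VI_dual_sol inner C F p -> weak_cvg inner v p ->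
  (forall n, inner (F (v n)) (v n - p) <= r n) -> r @ \oo --> 0 ->
  forall e N, 0 < e -> exists2 n, (N <= n)%N & `|v n - p| < e.
Proof.
move=> A5 vC pdual vp vr rcvg e N e0.
(* [A5] speaks of sequences avoiding their limit: either [p] is hit after [N] and the goal is
   immediate, or the tail avoids [p]. *)
have [[n Nn vn]|vNp] := pselect (exists2 n, (N <= n)%N & v n = p).
  by exists n => //; rewrite vn subrr normr0.
have vp' : weak_cvg inner (fun n => v (n + N)%N) p.
  by move=> u; rewrite (cvg_shiftn N (fun n => inner (v n) u)).
have [||eps eps0] := A5 (fun n => v (n + N)%N) p _ _ pdual vp'.
- by [].
- move=> n; apply/eqP => vn; apply: vNp.
  by exists (n + N)%N => //; exact: leq_addl.
set q := limn_einf _ => q0.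
have [c c0 cq] : exists2 c : R, 0 < c & (c%:E < q)%E.
  case: q q0 => [q||]; rewrite ?lte_fin => // q0.
    by exists (q / 2); rewrite ?lte_fin; lra.
  by exists 1; rewrite ?ltry.
move/limn_einf_gt_near: cq => cq.
pose a := c * e `^ (2 + eps).
have a0 : 0 < a by rewrite mulr_gt0// powR_gt0.
have rcvg' : r (n + N)%N @[n --> \oo] --> 0 by rewrite (cvg_shiftn N r).
have ra : \forall n \near \oo, r (n + N)%N < a.
  exact: cvgr_lt rcvg' _ a0.
near \oo => n; exists (n + N)%N; first exact: leq_addl.
rewrite ltNge; apply/negP => en.
have : (c%:E < (inner (F (v (n + N)%N)) (v (n + N)%N - p) /
          (`|v (n + N)%N - p| `^ (2 + eps)))%:E)%E by near: n.
have pw : e `^ (2 + eps) <= `|v (n + N)%N - p| `^ (2 + eps).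
  by apply: ge0_ler_powR; rewrite ?nnegrE ?addr_ge0// ltW.
rewrite lte_fin ltr_pdivlMr; last by apply: lt_le_trans pw; rewrite powR_gt0.
have : r (n + N)%N < a by near: n.
have := vr (n + N)%N; rewrite /a.
have := ler_wpM2l (ltW c0) pw; lra.
Unshelve. all: by end_near. Qed.

End VariationalInequality.

(** Subtracting the partial sums of [t] from [d] leaves a sequence that is eventually nonincreasing
    and bounded below. *)
Lemma quasi_fejer_cvg (R : realType) (d t : nat -> R) (N : nat) :
  (forall n, 0 <= d n) -> (forall n, 0 <= t n) -> cvg (series t @ \oo) ->
  (forall n, (N <= n)%N -> d n.+1 <= d n + t n) -> cvg (d @ \oo).
Proof.
move=> d0 t0 /cvg_ex[T tT] dt.
have tle n : series t n <= T.
  have ts : nondecreasing_seq (series t).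
    by apply/nondecreasing_seqP => k; rewrite -subr_ge0 seriesSB.
  rewrite -(cvg_lim _ tT)//; apply: nondecreasing_cvgn_le => //.
  by apply/cvg_ex; exists T.
have : cvg ((fun n => d (n + N)%N - series t (n + N)%N) @ \oo).
  apply: nonincreasing_is_cvgn.
    apply/nonincreasing_seqP => n; rewrite addSn.
    have := dt (n + N)%N (leq_addl _ _); have := seriesSB t (n + N)%N.
    by move=> /eqP; rewrite subr_eq => /eqP ->; lra.
  exists (- T) => _ [n _ <-]; have := d0 (n + N)%N; have := tle (n + N)%N; lra.
move=> /cvg_ex[l dl]; apply/cvg_ex; exists (l + T).
rewrite -(cvg_shiftn N d).
have tT' : series t (n + N)%N @[n --> \oo] --> T.
  by rewrite (cvg_shiftn N (series t)).
apply: cvg_trans (cvgD dl tT'); apply: near_eq_cvg; apply: nearW => n.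
by rewrite /= fctE subrK.
Qed.

(** * Step sizes, distance estimates and residuals of the algorithm *)

Section Algorithm.
Context (R : realType) (H : completeNormedModType R) (inner : H -> H -> R).
Context (C : set H) (F : H -> H) (mu : R) (xi lambda : nat -> R).
Context (z w : nat -> H).
Hypothesis ip : is_inner_product inner.
Hypothesis Ccvx : convex_subset C.
Hypothesis Fuc : unif_continuous F.
Hypothesis mu01 : 0 < mu < 1.
Hypothesis xi_ge0 : forall n, 0 <= xi n.
Hypothesis xi_cvg : cvg (series xi @ \oo).
Hypothesis lambda0_gt0 : 0 < lambda 0%N.
Hypothesis wE : forall n, is_metric_proj C (z n - lambda n *: F (z n)) (w n).
Hypothesis zS : forall n, z n.+1 = w n + lambda n *: (F (z n) - F (w n)).
Hypothesis lambdaS : forall n, lambda n.+1 =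
  if F (z n) != F (w n)
  then Num.min (mu * `|z n - w n| / `|F (z n) - F (w n)|) (lambda n + xi n)
  else lambda n + xi n.
Hypothesis zw : forall n, z n != w n.

Let D n := F (z n) - F (w n).

Lemma lambda_gt0 n : 0 < lambda n.
Proof.
case/andP: mu01 => mu0 _.
elim: n => // n IHn; rewrite lambdaS.
have h : 0 < lambda n + xi n by rewrite ltr_wpDr.
case: ifPn => // FD; rewrite lt_min h andbT.
apply: divr_gt0; last by rewrite normr_gt0 subr_eq0.
by rewrite mulr_gt0// normr_gt0 subr_eq0.
Qed.

Lemma lambdaS_le n : lambda n.+1 <= lambda n + xi n.
Proof. by rewrite lambdaS; case: ifPn => // _; rewrite ge_min lexx orbT. Qed.

Lemma lambdaS_mul_le n : lambda n.+1 * `|D n| <= mu * `|z n - w n|.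
Proof.
case/andP: mu01 => mu0 _.
rewrite lambdaS /D; case: ifPn => [FD|]; last first.
  by rewrite negbK => /eqP ->; rewrite subrr normr0 mulr0 mulr_ge0// ltW.
by rewrite -ler_pdivlMr ?normr_gt0 ?subr_eq0// ge_min lexx.
Qed.

Lemma lambdaS_mul_eq n : lambda n.+1 < lambda n + xi n ->
  lambda n.+1 * `|D n| = mu * `|z n - w n|.
Proof.
rewrite lambdaS /D; case: ifPn => [FD|]; last by rewrite ltxx.
rewrite gt_min ltxx orbF => h.
by rewrite min_l ?ltW// divfK// normr_eq0 subr_eq0.
Qed.

(** The shortfall of the new step size from its cap [lambda n + xi n]. *)
Let tau n := lambda n - lambda n.+1 + xi n.

Lemma tau_ge0 n : 0 <= tau n.
Proof. by have := lambdaS_le n; rewrite /tau; lra. Qed.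

(** The partial sums telescope to [lambda 0 - lambda n] plus those of [xi], and [lambda n] is
    positive. *)
Lemma cvg_series_tau : cvg (series tau @ \oo).
Proof.
have /cvg_ex[X xX] := xi_cvg.
have xle n : series xi n <= X.
  rewrite -(cvg_lim _ xX)//; apply: nondecreasing_cvgn_le => //.
  by apply/nondecreasing_seqP => k; rewrite -subr_ge0 seriesSB.
apply: nondecreasing_is_cvgn.
  by apply/nondecreasing_seqP => k; rewrite -subr_ge0 seriesSB tau_ge0.
exists (lambda 0%N + X) => _ [n _ <-].
suff -> : series tau n = lambda 0%N - lambda n + series xi n.
  by have := xle n; have := lambda_gt0 n; lra.
elim: n => [|n IHn]; first by rewrite /series /= !big_geq// subrr addr0.
have := seriesSB tau n; have := seriesSB xi n.
move=> /eqP; rewrite subr_eq => /eqP ->.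
move=> /eqP; rewrite subr_eq => /eqP ->.
by rewrite IHn /tau; ring.
Qed.

Lemma tau_cvg0 : tau @ \oo --> 0.
Proof. exact: cvg_series_cvg_0 cvg_series_tau. Qed.

(** A value strictly between [mu] and 1: [mu < q] gives contraction in good steps, [q < 1] a
    proportional loss of [lambda] in the others. *)
Let q := (1 + mu) / 2.

(* In the second alternative [lambda] drops by a fixed proportion of
   [lambda n], which is therefore controlled by the summable [tau n]. *)
Lemma step_dichotomy : exists2 K : R, 0 <= K &
  \forall n \near \oo, q * lambda n <= lambda n.+1 \/
    (`|z n - w n| <= K * tau n /\ `|z n.+1 - z n| <= K * tau n).
Proof.
case/andP: mu01 => mu0 mu1.
have q1 : 0 < 1 - q by rewrite /q; lra.
have [M M0 FM] := unif_continuous_affine_bound Fuc.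
have [d d0 dP] := unif_continuous_normP Fuc ltr01.
(* Chosen so that [k * (M * a + 1) <= mu * a] for every [a >= d], with equality at [a = d]. *)
pose k := mu * d / (M * d + 1).
have Md : 0 < M * d + 1 by rewrite ltr_wpDl// mulr_ge0// ltW.
have k0 : 0 < k by apply: divr_gt0 => //; exact: mulr_gt0.
have kE : k * (M * d + 1) = mu * d by rewrite divfK ?gt_eqF.
have qk : 0 < (1 - q) * k by rewrite mulr_gt0.
(* In a bad step [|z n - w n| <= mu^-1 * lambda n], the correction adds at most [lambda n], and
   [lambda n <= tau n / (1 - q)]. *)
exists ((mu^-1 + 1) / (1 - q)).
  by apply: divr_ge0; [rewrite addr_ge0 ?invr_ge0// ltW|exact: ltW].
have [N0 _ N0P] := cvgr_lt _ tau_cvg0 _ qk; exists N0 => // n /N0P /= tau_lt.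
have [|bad] := leP (q * lambda n) (lambda n.+1); first by left.
right.
have l0 := lambda_gt0 n; have l1 := lambda_gt0 n.+1.
have x0 := xi_ge0 n.
have lt : lambda n.+1 < lambda n by nra.
have tl : (1 - q) * lambda n <= tau n by rewrite /tau; lra.
have /lambdaS_mul_eq DE : lambda n.+1 < lambda n + xi n by lra.
(* Otherwise the residual is at least [d], while [lambda n.+1 < k]; the affine growth of [F] then
   contradicts [DE] by the choice of [k]. *)
have D1 : `|D n| < 1.
  rewrite ltNge; apply/negP => D1.
  have ad : d <= `|z n - w n|.
    by rewrite leNgt; apply/negP => /dP; rewrite ltNge D1.
  have lk : lambda n.+1 < k.
    by rewrite -(ltr_pM2l q1); apply: le_lt_trans tau_lt; nra.
  have Da : `|D n| <= M * `|z n - w n| + 1 by exact: FM.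
  set a := `|z n - w n| in DE ad Da.
  have h1 : mu * a < k * (M * a + 1).
    rewrite -DE; apply: (@lt_le_trans _ _ (k * `|D n|)).
      by rewrite ltr_pM2r//; apply: lt_le_trans D1.
    by rewrite ler_wpM2l// ltW.
  have h2 : k * (M * a + 1) * d <= mu * a * d.
    have -> : mu * a * d = k * (M * d + 1) * a by rewrite kE; ring.
    have h : k * d <= k * a by rewrite ler_pM2l.
    by lra.
  by move: h2; rewrite ler_pM2r// leNgt h1.
have Kt : (mu^-1 + 1) * lambda n <= (mu^-1 + 1) / (1 - q) * tau n.
  rewrite -mulrA ler_wpM2l ?addr_ge0 ?invr_ge0 ?(ltW mu0)//.
  by rewrite ler_pdivlMl.
have a_le : `|z n - w n| <= mu^-1 * lambda n.
  by rewrite ler_pdivlMl// -DE; have := normr_ge0 (D n); nra.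
split; apply: le_trans Kt; first by rewrite mulrDl mul1r; lra.
rewrite zS addrAC -/(D n); apply: le_trans (ler_normD _ _) _.
rewrite distrC normrZ gtr0_norm// mulrDl mul1r lerD//.
by rewrite -[leRHS]mulr1 ler_wpM2l ?ltW.
Qed.

(** Expand both squares around [w n]; the cross terms are controlled by the projection inequality at
    [u] and the dual inequality at [w n]. *)
Lemma lyapunov_step u n : VI_dual_sol inner C F u ->
  `|z n.+1 - u| ^+ 2 <=
    `|z n - u| ^+ 2 - `|z n - w n| ^+ 2 + (lambda n * `|D n|) ^+ 2.
Proof.
move=> [Cu udual]; have [Cw _] := wE n.
have l0 := lambda_gt0 n.
have pr := metric_proj_inner_le ip Ccvx (wE n) Cu.
have du := mulr_ge0 (ltW l0) (udual _ Cw).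
have -> : z n.+1 - u = lambda n *: D n + (w n - u).
  by rewrite zS -/(D n) addrAC addrC.
have -> : z n - u = (z n - w n) + (w n - u) by rewrite addrA subrK.
rewrite (sqr_normD ip (lambda n *: D n)) (sqr_normD ip (z n - w n)).
rewrite normrZ (gtr0_norm l0) (innerZl ip) [inner (D n) _](innerBl ip).
move: pr; rewrite addrAC (innerBl ip) (innerZl ip) -(opprB (w n) u).
rewrite !(innerNr ip); lra.
Qed.

Lemma good_step u n : VI_dual_sol inner C F u ->
  q * lambda n <= lambda n.+1 ->
  `|z n.+1 - u| ^+ 2 <=
    `|z n - u| ^+ 2 - (1 - (mu / q) ^+ 2) * `|z n - w n| ^+ 2.
Proof.
case/andP: mu01 => mu0 mu1 udual good.
have q0 : 0 < q by rewrite /q; lra.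
have : lambda n * `|D n| <= mu / q * `|z n - w n|.
  rewrite mulrAC ler_pdivlMr//; apply: le_trans (lambdaS_mul_le n).
  by rewrite mulrAC [lambda n * q]mulrC ler_wpM2r.
rewrite -(@ler_pXn2r _ 2) ?nnegrE ?mulr_ge0 ?invr_ge0 ?(ltW q0) ?(ltW mu0)
  ?(ltW (lambda_gt0 n))//.
rewrite [in leRHS]exprMn; have := lyapunov_step n udual; lra.
Qed.

Lemma contraction_gt0 : 0 < 1 - (mu / q) ^+ 2.
Proof.
case/andP: mu01 => mu0 mu1.
have q0 : 0 < q by rewrite /q; lra.
have r1 : mu / q < 1 by rewrite ltr_pdivrMr// mul1r /q; lra.
by rewrite subr_gt0 expr_lt1// divr_ge0// ltW.
Qed.

Lemma cvg_dist_dual_sol u : VI_dual_sol inner C F u ->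
  cvg ((fun n => `|z n - u|) @ \oo).
Proof.
move=> udual; have [K K0 [N _ NP]] := step_dichotomy.
apply: (@quasi_fejer_cvg _ _ (fun n => K * tau n) N) => //.
- by move=> n; rewrite mulr_ge0// tau_ge0.
- exact: (@is_cvg_seriesZ R tau K cvg_series_tau).
move=> n /NP /= [good|[_ bad]].
  have : `|z n.+1 - u| <= `|z n - u|.
    rewrite -(@ler_pXn2r _ 2) ?nnegrE//; have := good_step udual good.
    have := mulr_ge0 (ltW contraction_gt0) (sqr_ge0 `|z n - w n|); lra.
  by have := mulr_ge0 K0 (tau_ge0 n); lra.
have := ler_distD (z n) (z n.+1) u; lra.
Qed.

Hypothesis dual_nonempty : VI_dual_sol inner C F !=set0.

(** In good steps the squared residual is bounded by a multiple of the decrease of a convergent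
    sequence, in bad steps the residual is at most [K * tau n]. *)
Lemma residual_cvg0 : `|z n - w n| @[n --> \oo] --> 0.
Proof.
have [u udual] := dual_nonempty.
have [K K0 dich] := step_dichotomy.
have /cvg_ex[l dl] := cvg_dist_dual_sol udual.
have c0 := contraction_gt0; set c := 1 - _ in c0.
have dS : `|z n - u| ^+ 2 - `|z n.+1 - u| ^+ 2 @[n --> \oo] --> 0.
  rewrite -[X in _ --> X](subrr (l * l)).
  have dl' : `|z n.+1 - u| @[n --> \oo] --> l.
    by have := cvg_shiftS (fun n => `|z n - u|) (nbhs l); rewrite /= => ->.
  by apply: cvgB; apply: cvgM.
have Kt : K * tau n @[n --> \oo] --> 0.
  rewrite -[X in _ --> X](mulr0 K).
  by apply: cvgM; [exact: cvg_cst|exact: tau_cvg0].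
apply/cvgrPdist_lt => e e0.
have ce0 : 0 < c * e ^+ 2 by rewrite mulr_gt0// exprn_gt0.
near=> n; rewrite sub0r normrN normr_id.
have : K * tau n < e by near: n; exact: cvgr_lt Kt _ e0.
have : `|z n - u| ^+ 2 - `|z n.+1 - u| ^+ 2 < c * e ^+ 2.
  by near: n; exact: cvgr_lt dS _ ce0.
have : q * lambda n <= lambda n.+1 \/
    (`|z n - w n| <= K * tau n /\ `|z n.+1 - z n| <= K * tau n) by near: n.
move=> [/(good_step udual) h|[h _]] h3 h4; last by lra.
rewrite -(@ltr_pXn2r _ 2) ?nnegrE ?(ltW e0)// -(ltr_pM2l c0).
rewrite -/c in h; lra.
Unshelve. all: by end_near. Qed.

Lemma defect_cvg0 : `|D n| @[n --> \oo] --> 0.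
Proof.
apply/cvgrPdist_lt => e e0; have [d d0 dP] := unif_continuous_normP Fuc e0.
near=> n; rewrite sub0r normrN normr_id; apply: dP; near: n.
exact: cvgr_lt residual_cvg0 _ d0.
Unshelve. all: by end_near.
Qed.

(* Otherwise [lambda] would tend to [0]; but once [|D n| < mu * e] the
   step size could no longer decrease. *)
Lemma residual_ratio_small e N : 0 < e ->
  exists2 n, (N <= n)%N & `|z n - w n| <= e * lambda n.
Proof.
move=> e0; case/andP: mu01 => mu0 mu1; apply: contrapT => none.
have big n : (N <= n)%N -> e * lambda n < `|z n - w n|.
  by move=> Nn; rewrite ltNge; apply/negP => ?; apply: none; exists n.
have mue : 0 < mu * e by rewrite mulr_gt0.
have [N1 _ DN] := cvgr_lt _ defect_cvg0 _ mue.
pose N2 := maxn N N1.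
have lmono n : (N2 <= n)%N -> lambda N2 <= lambda n.
  elim: n => [|n IHn]; first by rewrite leqn0 => /eqP ->.
  rewrite leq_eqVlt => /predU1P[->//|]; rewrite ltnS => N2n.
  apply: le_trans (IHn N2n) _; rewrite leNgt; apply/negP => lt.
  move: N2n; rewrite geq_max => /andP[/big bign /DN /= Dn].
  have x0 := xi_ge0 n; have l0 := lambda_gt0 n; have l1 := lambda_gt0 n.+1.
  have /lambdaS_mul_eq DE : lambda n.+1 < lambda n + xi n by lra.
  have h1 : mu * (e * lambda n) < mu * `|z n - w n| by rewrite ltr_pM2l.
  have h2 : lambda n.+1 * `|D n| <= lambda n * (mu * e).
    by apply: ler_pM => //; exact: ltW.
  by lra.
(* As [lambda] stays above [lambda N2], the vanishing residual must fall below [e * lambda n],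
   contrary to [big]. *)
have el0 : 0 < e * lambda N2 by rewrite mulr_gt0// lambda_gt0.
have [N3 _ aN] := cvgr_lt _ residual_cvg0 _ el0.
have := aN (maxn N2 N3) (leq_maxr _ _) => /=.
have N2N : (N2 <= maxn N2 N3)%N by exact: leq_maxl.
have := big _ (leq_trans (leq_maxl N N1) N2N).
have : e * lambda N2 <= e * lambda (maxn N2 N3) by rewrite ler_pM2l// lmono.
lra.
Qed.

(** Dividing the projection inequality by [lambda n] costs [e]; replacing [F (z n)] by [F (w n)]
    costs [|D n|]. *)
Lemma approx_VI e n y : `|z n - w n| <= e * lambda n -> C y ->
  - ((e + `|D n|) * `|y - w n|) <= inner (F (w n)) (y - w n).
Proof.
move=> ze Cy; have l0 := lambda_gt0 n.
have := metric_proj_inner_le ip Ccvx (wE n) Cy.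
rewrite addrAC (innerBl ip) (innerZl ip) => pr.
have h1 := normr_inner_le ip (z n - w n) (y - w n).
have h2 : `|z n - w n| * `|y - w n| <= e * lambda n * `|y - w n|.
  by rewrite ler_wpM2r.
have h3 : - (e * `|y - w n|) <= inner (F (z n)) (y - w n).
  rewrite -(ler_pM2l l0); move: h1; rewrite ler_norml => /andP[h1 _]; lra.
have := inner_le_norm ip (D n) (y - w n).
rewrite [inner (D n) _](innerBl ip); lra.
Qed.

Lemma w_bounded : exists M, forall n, `|w n| <= M.
Proof.
have [u udual] := dual_nonempty.
have bnd (f : nat -> R) : cvg (f @ \oo) -> exists M, forall n, f n <= M.
  move=> /cvg_seq_bounded[M [_ MP]]; exists (M + 1) => n.
  apply: le_trans (ler_norm _) _; apply: MP => //; by rewrite ltrDl.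
have [A AP] := bnd _ (cvg_dist_dual_sol udual).
have [|B BP] := bnd (fun n => `|z n - w n|).
  by apply/cvg_ex; exists 0; exact: residual_cvg0.
exists (A + B + `|u|) => n.
rewrite -[w n](subrK u); apply: le_trans (ler_normD _ _) _; rewrite lerD2r.
apply: le_trans (ler_distD (z n) _ _) _.
by rewrite addrC lerD// distrC.
Qed.

End Algorithm.

Theorem theorem4p2 (R : realType) (H : completeNormedModType R)
  (inner : H -> H -> R) (C : set H) (F : H -> H)
  (mu : R) (xi : nat -> R) (lambda : nat -> R) (z w : nat -> H) :
  is_inner_product inner ->
  C !=set0 -> closed C -> convex_subset C ->
  (* (A1) *) VI_dual_sol inner C F !=set0 ->
  (* (A2) *) quasimonotone inner F ->
  (* (A3) *) unif_continuous F ->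
  (* (A4) *) (forall (x : nat -> H) (y : H), weak_cvg inner x y ->
       ((`|F y|)%:E <= limn_einf (fun n => (`|F (x n)|)%:E))%E) ->
  (* (A5) *) (forall (v : nat -> H) (u : H),
       (forall n, C (v n)) -> (forall n, v n != u) ->
       VI_dual_sol inner C F u -> weak_cvg inner v u ->
       exists2 eps : R, 0 <= eps &
         (0 < limn_einf (fun n =>
            (inner (F (v n)) (v n - u) / (`|v n - u| `^ (2 + eps)))%:E))%E) ->
  (forall x, VI_sol inner C F x -> ~ VI_dual_sol inner C F x -> F x != 0) ->
  (* Algorithm 3.1 *)
  0 < mu < 1 ->
  (forall n, 0 <= xi n) -> cvg (series xi @ \oo) ->
  0 < lambda 0 ->
  (forall n, is_metric_proj C (z n - lambda n *: F (z n)) (w n)) ->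
  (forall n, z n.+1 = w n + lambda n *: (F (z n) - F (w n))) ->
  (forall n, lambda n.+1 =
     if F (z n) != F (w n)
     then Num.min (mu * `|z n - w n| / `|F (z n) - F (w n)|) (lambda n + xi n)
     else lambda n + xi n) ->
  (forall n, z n != w n) ->
  exists2 zl : H, VI_sol inner C F zl & z @ \oo --> zl.
Proof.
move=> ip C0 Ccl Ccvx A1 Fqm Fuc A4 A5 Fne0 mu01 xi0 xicvg l0 wE zS lS zw.
have Fc := unif_continuous_continuous Fuc.
have cvgd := cvg_dist_dual_sol ip Ccvx Fuc mu01 xi0 xicvg l0 wE zS lS zw.
have acvg := residual_cvg0 ip Ccvx Fuc mu01 xi0 xicvg l0 wE zS lS zw A1.
have Dcvg := defect_cvg0 ip Ccvx Fuc mu01 xi0 xicvg l0 wE zS lS zw A1.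
have [B wB] := w_bounded ip Ccvx Fuc mu01 xi0 xicvg l0 wE zS lS zw A1.
pose d (k : nat) : R := k.+1%:R^-1.
have d0 k : 0 < d k by rewrite invr_gt0.
have dcvg : d @ \oo --> 0.
  apply/cvgrPdist_lt => e e0; near=> k.
  rewrite sub0r normrN gtr0_norm//; near: k.
  exact: near_infty_natSinv_lt (PosNum e0).
have /choice[s sP] : forall k, exists n,
    (k <= n)%N /\ `|z n - w n| <= d k * lambda n.
  move=> k; have [n kn zn] := residual_ratio_small ip Ccvx Fuc mu01 xi0 xicvg
    l0 wE zS lS zw A1 k (d0 k).
  by exists n.
have [t [p [tk wp]]] := bounded_weak_subseq ip (fun k => wB (s k)).
pose m k := s (t k).
have mk k : (k <= m k)%N.
  by apply: leq_trans (tk k) _; case: (sP (t k)).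
(* [m] need not be increasing; [k <= m k] suffices for it to tend to infinity. *)
have moo : m @ \oo --> \oo.
  move=> A [N _ NA]; exists N => // k /= Nk.
  by apply: NA; exact: leq_trans (mk k).
pose v k := w (m k).
pose r k := d (t k) + `|F (z (m k)) - F (w (m k))|.
have vC k : C (v k) by case: (wE (m k)).
have vB k : `|v k| <= B by exact: wB.
have r0 k : 0 <= r k by rewrite addr_ge0// ltW.
have rcvg : r @ \oo --> 0.
  rewrite -[X in _ --> X](addr0 0); apply: cvgD.
    apply: (cvg_comp t d) dcvg.
    move=> A [N _ NA]; exists N => // k /= Nk.
    by apply: NA; exact: leq_trans (tk k).
  exact: (cvg_comp m (fun n => `|F (z n) - F (w n)|)) moo Dcvg.
have vVI k y : C y -> - (r k * `|y - v k|) <= inner (F (v k)) (y - v k).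
  apply: (approx_VI ip Ccvx mu01 xi0 l0 wE lS zw).
  by case: (sP (t k)).
have Cp : C p := weak_cvg_closed_convex ip Ccl Ccvx vC wp.
have pdual : VI_dual_sol inner C F p.
  (* If [F p = 0] then [p] solves the inequality trivially, and the assumption on solutions outside
     [S_D] puts [p] in [S_D]. *)
  have [Fp|Fp] := eqVneq (F p) 0.
    apply: contrapT => pnd.
    have psol : VI_sol inner C F p.
      by split=> // y _; rewrite Fp (inner0l ip).
    by have := Fne0 _ psol pnd; rewrite Fp eqxx.
  exact: (weak_limit_dual_sol ip Fqm Fc (A4 _ _ wp) vB wp r0 rcvg vVI Cp Fp).
exists p; first exact: (VI_dual_sol_sub ip Ccvx Fc pdual).
(* Testing the approximate inequality at [p] itself bounds the numerator of [A5] from above. *)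
have vr k : inner (F (v k)) (v k - p) <= r k * (`|p| + B).
  have : - (r k * `|p - v k|) <= inner (F (v k)) (p - v k) := vVI k p Cp.
  rewrite -(opprB (v k) p) (innerNr ip) lerN2 normrN => h.
  apply: le_trans h _; rewrite ler_wpM2l// distrC.
  by apply: le_trans (ler_normB _ _) _; rewrite lerD2l.
have rcvg' : (fun k => r k * (`|p| + B)) @ \oo --> 0.
  rewrite -[X in _ --> X](mul0r (`|p| + B)).
  by apply: cvgM => //; exact: cvg_cst.
have cluster := weak_limit_strong_cluster A5 vC pdual wp vr rcvg'.
(* The distance to [p] converges along the whole sequence, so indices [m k] with [v k] near [p] and
   small residual determine its limit. *)
have /cvg_ex[l dl] := cvgd _ pdual.
have l0' : l = 0.
  apply/eqP; rewrite eq_le; apply/andP; split; last first.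
    by apply: (closed_cvg _ (@closed_ge R _) _ _ dl); apply: nearW => n /=.
  apply/ler_addgt0Pr => e e0; rewrite add0r leNgt; apply/negP => el.
  have e2 : 0 < e / 2 by rewrite divr_gt0.
  have [N1 _ N1P] : \forall n \near \oo, e < `|z n - p|.
    exact: cvgr_gt dl _ el.
  have [N2 _ N2P] : \forall n \near \oo, `|z n - w n| < e / 2.
    exact: cvgr_lt acvg _ e2.
  have [k] := cluster _ (maxn N1 N2) e2.
  rewrite geq_max => /andP[N1k N2k] vk.
  have h1 : e < `|z (m k) - p| := N1P _ (leq_trans N1k (mk k)).
  have h2 : `|z (m k) - w (m k)| < e / 2 := N2P _ (leq_trans N2k (mk k)).
  have := ler_distD (w (m k)) (z (m k)) p.
  rewrite /v in vk; lra.
apply/cvgrPdist_lt => e e0; move: dl; rewrite l0' => dl; near=> n.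
by rewrite distrC; near: n; exact: cvgr_lt dl _ e0.
Unshelve. all: by end_near. Qed.
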